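(* For any integer $s\ge0$, $$A_{s+3}=\frac{64}{\pi}\left(\sum_{k=0}^{s}\binom{s}{k}\frac{1}{(2k+1)(2k+3)(2k+5)}\right).$$ In particular, $A_s\sim\frac{8}{\pi}\cdot\frac{2^s}{s^3}$ as $s$ tends to infinity.
   Context: With $\mathrm{Cat}_n=\frac1{n+1}\binom{2n}{n}$, for each integer $s\ge0$ define $$S(T_s)(t)=\sum_{m_1,\dots,m_s\ge0}\mathrm{Cat}_{m_1}\cdots\mathrm{Cat}_{m_s}\,\mathrm{Cat}_{m_1+\cdots+m_s}\,t^{2m_1+\cdots+2m_s},\qquad A_s=S(T_s)(1/4),$$ the sum being over nonnegative integers (it converges at $t=1/4$); this is the sum associated with the star tree $T_s$ with a central vertex connected to $s$ leaves. *)

(* Defs.v *)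
From HB Require Import structures.
From mathcomp Require Import all_boot all_order all_algebra.
From mathcomp Require Import all_classical all_reals all_analysis.
Set Implicit Arguments.
Unset Strict Implicit.
Unset Printing Implicit Defensive.
Import Order.TTheory GRing.Theory Num.Theory.
Import numFieldNormedType.Exports.
Local Open Scope classical_set_scope.
Local Open Scope ring_scope.

Definition catalan (R : realType) (n : nat) : R := 'C(2 * n, n)%:R / n.+1%:R.

(* S(T_s)(t).  Every exponent of t is even, so all terms are nonnegative for
   every real t and the unordered sum in [0, +oo] is the sum of the multiple
   series, with value +oo exactly when the series diverges. *)
Definition star_sum (R : realType) (s : nat) (t : R) : \bar R :=
  \esum_(m in [set: {ffun 'I_s -> nat}])
    ((\prod_(i < s) catalan R (m i)) * catalan R (\sum_(i < s) m i)%N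
       * t ^+ (\sum_(i < s) 2 * m i)%N)%:E.

Definition star_value (R : realType) (s : nat) : \bar R := star_sum s (1 / 4 : R).

(* Main.v *)
(* The Catalan numbers are moments: with [q(x) = x^2 / (1 + x^2)^2],
     [Cat_n / 16^n = 8 / pi * \int_0^1 q^n * (1 - x^2)^2 / (1 + x^2)^3].
   As [\sum_k Cat_k * q^k = 1 + x^2] on [[0, 1]], Tonelli turns the multiple
   series into
     [A_(s+3) = 8 / pi * \int_0^1 (1 - x^2)^2 * (1 + x^2)^s],
   and expanding [(1 + x^2)^s] gives the closed form.  For the asymptotics, put
     [B j s = \int_0^1 ((1 - x^2) / 2)^j * ((1 + x^2) / 2)^s].
   Integration by parts gives
     [(2s + 2j + 3) B j (s+1) = (s+1) B j s + j B (j-1) (s+1)]  (j > 0),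
   a recurrence in [s] with contraction factor tending to [1 / 2], whence
   [s^(j+1) B j s] tends to [j!] by induction on [j]; take [j = 2]. *)
Require Import Defs.
From HB Require Import structures.
From mathcomp Require Import all_boot all_order all_algebra.
From mathcomp Require Import all_classical all_reals all_analysis.
From mathcomp Require Import measurable_realfun zify ring lra.
Set Implicit Arguments.
Unset Strict Implicit.
Unset Printing Implicit Defensive.
Import Order.TTheory GRing.Theory Num.Theory.
Import numFieldNormedType.Exports.
Local Open Scope classical_set_scope.
Local Open Scope ring_scope.

(** * Catalan numbers: recurrence, convolution, generating series *)

Lemma catalan_ge0 (R : realType) (n : nat) : 0 <= catalan R n.
Proof. by rewrite /catalan divr_ge0. Qed.

Lemma catalan0 (R : realType) : catalan R 0 = 1.
Proof. by rewrite /catalan muln0 bin0 divr1. Qed.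

(** Two absorption identities lead from ['C(2 * n, n)] through ['C((2 * n).+1, n)] to the next
    central binomial coefficient. *)
Lemma catalan_succ (R : realType) (n : nat) :
  n.+2%:R * catalan R n.+1 = (4 * n + 2)%:R * catalan R n.
Proof.
have e1 := mul_bin_diag (2 * n.+1) n.
have e2 := mul_bin_down (2 * n).+1 n.
rewrite mulnS /= add2n /= in e1 *.
have e3 : ((2 * n).+1 - n)%N = n.+1 by rewrite mul2n -addnn subSn ?leq_addl// addnK.
rewrite e3 /= in e2.
rewrite /catalan mulnS add2n (mulrC n.+2%:R) divfK ?pnatr_eq0//.
move: e1 e2.
move/(congr1 (fun k => k%:R : R)) => e1.
move/(congr1 (fun k => k%:R : R)) => e2.
rewrite !natrM in e1 e2.
have n1 : n.+1%:R != 0 :> R by rewrite pnatr_eq0.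
apply: (mulfI n1); rewrite -e1.
have -> : n.+1%:R * ((4 * n + 2)%:R * ('C(2 * n, n)%:R / n.+1%:R)) =
  2 * ((2 * n).+1%:R * 'C(2 * n, n)%:R) :> R.
  by rewrite natrD natrM -[(2 * n).+1%:R]natr1 natrM; field.
by rewrite e2 -[(2 * n).+2%:R]natr1 -[(2 * n).+1%:R]natr1 -natr1 natrM; ring.
Qed.

(* Both sides satisfy the recurrence of [catalan_succ]; for the convolution,
   symmetry gives [sum (i+1) C_i C_(n-i) = (n+2)/2 sum C_i C_(n-i)]. *)
Lemma catalan_convolution (R : realType) (n : nat) :
  \sum_(i < n.+1) catalan R i * catalan R (n - i) = catalan R n.+1.
Proof.
pose D n := \sum_(i < n.+1) catalan R i * catalan R (n - i).
pose T n := \sum_(i < n.+1) i.+1%:R * (catalan R i * catalan R (n - i)).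
have TD m : 2 * T m = m.+2%:R * D m.
  rewrite mulr2n mulrDl mul1r {2}/T (reindex_inj rev_ord_inj) /= -big_split /=.
  rewrite mulr_sumr; apply: eq_bigr => i _.
  rewrite subSS subKn -1?ltnS// [catalan R (m - i) * _]mulrC -mulrDl -natrD.
  by rewrite addnS addSn subnKC // -ltnS.
(* Peel off [i = 0], then apply [catalan_succ] to each remaining term, with
   [4 i + 2 = 4 (i + 1) - 2]. *)
have TS m : T m.+1 = catalan R m.+1 + (4 * T m - 2 * D m).
  rewrite {1}/T big_ord_recl /= subn0 catalan0 !mul1r; congr (_ + _).
  rewrite /T /D !mulr_sumr -sumrB; apply: eq_bigr => i _.
  rewrite /bump /= add1n subSS mulrA catalan_succ; ring.
rewrite -/(D n); elim: n => [|n IH].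
  have := catalan_succ R 0; rewrite /D big_ord_recl big_ord0 /= catalan0; lra.
have e : 2 * T n.+1 = 2 * catalan R n.+1 + (4 * (2 * T n) - 4 * D n).
  by rewrite TS; ring.
rewrite !TD IH in e.
have n3 : n.+3%:R != 0 :> R by rewrite pnatr_eq0.
apply: (mulfI n3); rewrite e (catalan_succ R n.+1); ring.
Qed.

(** A finite form of [S = 1 + q S^2]: the square of the truncated series [P] has coefficients
    [catalan R n.+1] for [n < N], at most that beyond, and none from [2 * N] on. *)
Lemma catalan_partial_sum_bounds (R : realType) (q : R) (N : nat) : 0 <= q ->
  let S M := \sum_(0 <= k < M) catalan R k * q ^+ k in
  S N.+1 <= 1 + q * S N ^+ 2 <= S (2 * N).+1.
Proof.
move=> q0; set S := (fun M : nat => _); rewrite /=; pose P := \poly_(i < N) catalan R i.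
have SP : S N = P.[q] by rewrite horner_poly /S big_mkord.
have sP : (size (P ^+ 2) <= 2 * N)%N.
  rewrite expr2 (leq_trans (size_polyMleq _ _))//.
  by rewrite (leq_trans (leq_pred _))// mul2n -addnn leq_add// size_poly.
have SS M : S M.+1 = 1 + q * \sum_(0 <= k < M) catalan R k.+1 * q ^+ k.
  rewrite /S big_nat_recl// catalan0 expr0 mulr1; congr (_ + _).
  by rewrite mulr_sumr; apply: eq_bigr => k _; rewrite exprS mulrCA.
have cP n : (P ^+ 2)`_n <= catalan R n.+1.
  rewrite expr2 coefM -catalan_convolution ler_sum// => j _.
  by rewrite !coef_poly ler_pM//; case: ifP => // _; exact: catalan_ge0.
have cPlt n : (n < N)%N -> (P ^+ 2)`_n = catalan R n.+1.
  move=> nN; rewrite expr2 coefM -catalan_convolution; apply: eq_bigr => j _.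
  have jN : (j < N)%N by rewrite (leq_ltn_trans _ nN)// -ltnS.
  by rewrite !coef_poly jN (leq_ltn_trans (leq_subr _ _) nN).
rewrite !SS !lerD2l SP -horner_exp (horner_coef_wide _ sP).
rewrite -(big_mkord xpredT (fun i => (P ^+ 2)`_i * q ^+ i)).
apply/andP; split; apply: ler_wpM2l => //.
  rewrite (@big_cat_nat _ _ _ N 0 (2 * N)) //=; last by rewrite mul2n -addnn leq_addr.
  rewrite -[leLHS]addr0 lerD//.
    by apply: ler_sum_nat => i /andP[_ iN]; rewrite cPlt.
  rewrite sumr_ge0// => i _; rewrite mulr_ge0// ?exprn_ge0// expr2 coefM.
  rewrite sumr_ge0// => j _; rewrite !coef_poly mulr_ge0//;
    by case: ifP => // _; exact: catalan_ge0.
by apply: ler_sum => i _; rewrite ler_wpM2r ?exprn_ge0.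
Qed.

(* The partial sums stay below the smaller root [1 + v^2] of
   [S = 1 + q S^2], so their limit, itself a root, must be [1 + v^2]. *)
Lemma cvg_catalan_series (R : realType) (v : R) : 0 <= v <= 1 ->
  (\sum_(0 <= k < N) catalan R k * (v ^+ 2 / (1 + v ^+ 2) ^+ 2) ^+ k)
    @[N --> \oo] --> 1 + v ^+ 2.
Proof.
move=> /andP[v0 v1]; set q := v ^+ 2 / _.
have u1 : 1 + v ^+ 2 > 0 by rewrite ltr_pwDl// sqr_ge0.
have q0 : 0 <= q by rewrite divr_ge0 ?exprn_ge0// ltW.
pose S N := \sum_(0 <= k < N) catalan R k * q ^+ k.
have bnd N : S N.+1 <= 1 + q * S N ^+ 2 <= S (2 * N).+1.
  exact: catalan_partial_sum_bounds.
have Sge0 N : 0 <= S N.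
  by rewrite sumr_ge0// => k _; rewrite mulr_ge0 ?catalan_ge0 ?exprn_ge0.
have fix1 : 1 + q * (1 + v ^+ 2) ^+ 2 = 1 + v ^+ 2.
  by rewrite divfK// expf_neq0// gt_eqF.
have Sle N : S N <= 1 + v ^+ 2.
  elim: N => [|N IH]; first by rewrite /S big_geq// ltW.
  have /andP[+ _] := bnd N; move/le_trans; apply.
  by rewrite -[leRHS]fix1 lerD2l ler_wpM2l// lerXn2r// nnegrE ?Sge0 ?ltW.
have Snd : nondecreasing_seq S.
  apply/nondecreasing_seqP => n; rewrite /S big_nat_recr//= lerDl.
  by rewrite mulr_ge0 ?catalan_ge0 ?exprn_ge0.
have Scvg : cvgn S.
  by apply: nondecreasing_is_cvgn => //; exists (1 + v ^+ 2) => _ [N _ <-]; exact: Sle.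
suff <- : limn S = 1 + v ^+ 2 by [].
set l := limn S.
have ll : l <= 1 + v ^+ 2 by apply: limr_le => //; near=> N; exact: Sle.
have Sl N : S N <= l by apply: nondecreasing_cvgn_le.
have le1 : l <= 1 + q * l ^+ 2.
  apply: limr_le => //; near=> N.
  have /andP[+ _] := bnd N; move/(le_trans (Snd _ _ (leqnSn N)))/le_trans; apply.
  by rewrite lerD2l ler_wpM2l// lerXn2r// nnegrE (le_trans (Sge0 N)).
have ge1 : 1 + q * l ^+ 2 <= l.
  have c1 : (1 + q * (S N * S N)) @[N --> \oo] --> 1 + q * (l * l).
    apply: cvgD; first exact: cvg_cst.
    by apply: cvgM; [exact: cvg_cst|exact: cvgM].
  rewrite expr2 -(cvg_lim _ c1)//; apply: limr_le.
    by apply/cvg_ex; eexists; exact: c1.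
  near=> N; have /andP[_] := bnd N.
  by rewrite -expr2; move/le_trans; apply.
have [lu|ul|//] := ltgtP l (1 + v ^+ 2); last by rewrite leNgt ul in ll.
have eql : l = 1 + q * l ^+ 2 by apply: le_anti; rewrite le1 ge1.
(* Here [v <= 1] excludes a smaller root: [u <= 2] gives [2 q u <= 1], whereas a root [l < u] would
   give [q (u + l) = 1], hence [2 q u > 1]. *)
have u2 : 1 + v ^+ 2 <= 2 by rewrite lerD2l expr_le1.
move: (1 + v ^+ 2) u2 fix1 eql lu u1 => u u2 fix1 eql lu u1.
have l0 : 0 <= l by rewrite (le_trans (Sge0 0)).
have q1 : q * (u + l) = 1.
  have ul0 : u - l != 0 by rewrite subr_eq0 gt_eqF.
  by apply: (mulfI ul0); lra.
have q2 : 2 * q * u <= 1.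
  by rewrite -(ler_pM2r u1); lra.
have qgt : 0 < q.
  rewrite lt_neqAle q0 andbT eq_sym; apply: contra_eq_neq q1 => ->.
  by rewrite mul0r eq_sym oner_neq0.
have : q * l < q * u by rewrite ltr_pM2l.
lra.
Unshelve. all: by end_near.
Qed.

(** * Derivatives and the fundamental theorem of calculus on [0, 1] *)

Section integral01.
Context (R : realType).
Implicit Types f g F : R -> R.
Let mu := @lebesgue_measure R.

(* An alias for [is_derive x 1 f df] that is not a type class: instance search
   is far too slow on rational functions. *)
Definition has_deriv f (x df : R) : Prop := is_derive x 1 f df.

Lemma has_deriv_cst (c x : R) : has_deriv (fun=> c) x 0.
Proof. exact: is_derive_cst. Qed.

Lemma has_deriv_id (x : R) : has_deriv (fun y => y) x 1.
Proof. exact: is_derive_id. Qed.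

Lemma has_deriv_atan (x : R) : has_deriv (fun y => atan y) x (1 + x ^+ 2)^-1.
Proof. exact: is_derive1_atan. Qed.

Lemma has_derivD f g (x df dg : R) : has_deriv f x df -> has_deriv g x dg ->
  has_deriv (fun y => f y + g y) x (df + dg).
Proof. by move=> ? ?; exact: is_deriveD. Qed.

Lemma has_derivN f (x df : R) : has_deriv f x df ->
  has_deriv (fun y => - f y) x (- df).
Proof. by move=> ?; exact: is_deriveN. Qed.

Lemma has_derivM f g (x df dg : R) : has_deriv f x df -> has_deriv g x dg ->
  has_deriv (fun y => f y * g y) x (f x * dg + g x * df).
Proof. by move=> ? ?; exact: is_deriveM. Qed.

Lemma has_derivX f n (x df : R) : has_deriv f x df ->
  has_deriv (fun y => f y ^+ n) x (n%:R * f x ^+ n.-1 * df).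
Proof.
by move=> ?; rewrite /has_deriv -[X in is_derive _ _ X]exprfctE; exact: is_deriveX.
Qed.

Lemma has_derivV f (x df : R) : has_deriv f x df -> f x != 0 ->
  has_deriv (fun y => (f y)^-1) x (- (f x) ^- 2 * df).
Proof. by move=> ? ?; exact: is_deriveV. Qed.

Lemma has_deriv_eq f (x df dg : R) : has_deriv f x df -> df = dg ->
  has_deriv f x dg.
Proof. by move=> ? <-. Qed.

Lemma has_deriv_continuous f :
  (forall x : R, exists df, has_deriv f x df) -> continuous f.
Proof.
move=> h x; have [df [dfx _]] := h x.
exact/differentiable_continuous/derivable1_diffP.
Qed.

Lemma FTC01 F f : (forall x : R, has_deriv F x (f x)) -> continuous f ->
  \int[mu]_(x in `[0, 1]) f x = F 1 - F 0.
Proof.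
move=> dF cf; have cF : continuous F by apply: has_deriv_continuous => x; exists (f x).
rewrite /Rintegral (@continuous_FTC2 _ f F)//.
- exact: continuous_subspaceT.
- split.
  + by move=> x _; case: (dF x).
  + by apply: cvg_at_right_filter; exact: cF.
  + by apply: cvg_at_left_filter; exact: cF.
- by move=> x _; rewrite derive1E; case: (dF x).
Qed.

Lemma integrable01 f : continuous f -> mu.-integrable `[0, 1] (EFin \o f).
Proof.
move=> cf; apply: continuous_compact_integrable; first exact: segment_compact.
exact: continuous_subspaceT.
Qed.

Lemma integral01_Rintegral f : continuous f ->
  (\int[mu]_(x in `[0%R, 1%R]) (f x)%:E)%E = (\int[mu]_(x in `[0, 1]) f x)%:E.
Proof.
by move=> cf; rewrite fineK//; apply: integrable_fin_num => //; exact: integrable01.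
Qed.

Lemma oneDsqr_neq0 (x : R) : 1 + x ^+ 2 != 0.
Proof. by rewrite gt_eqF// ltr_pwDl// sqr_ge0. Qed.

End integral01.

(* A factor [c * y] is eta-reduced by unification and not recognized below; write
   [y * c] instead. *)
Ltac derive_pt := cbv beta; lazymatch goal with
  | |- has_deriv (fun y => y) _ _ => apply: has_deriv_id
  | |- has_deriv (@atan _) _ _ => apply: has_deriv_atan
  | |- has_deriv (fun y => _ + _) _ _ => apply: has_derivD; derive_pt
  | |- has_deriv (fun y => - _) _ _ => apply: has_derivN; derive_pt
  | |- has_deriv (fun y => _ * _) _ _ => apply: has_derivM; derive_pt
  | |- has_deriv (fun y => _ ^+ _) _ _ => apply: has_derivX; derive_pt
  | |- has_deriv (fun y => _^-1) _ _ => apply: has_derivV; derive_pt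
  | |- has_deriv _ _ _ => apply: has_deriv_cst
  | |- is_true (_ != 0) => by rewrite ?expf_neq0 ?oneDsqr_neq0
  end.

(** * Catalan numbers as moments *)

Section catalan_moments.
Context (R : realType).
Let mu := @lebesgue_measure R.

(* With [x = tan f], these are [sin (2 f) ^+ 2 / 4] and
   [cos (2 f) ^+ 2 * cos f ^+ 2]. *)
Definition catalan_arg (x : R) : R := x ^+ 2 / (1 + x ^+ 2) ^+ 2.
Definition catalan_weight (x : R) : R := (1 - x ^+ 2) ^+ 2 / (1 + x ^+ 2) ^+ 3.

Lemma continuous_catalan_arg : continuous catalan_arg.
Proof.
by apply: has_deriv_continuous => x; eexists; rewrite /catalan_arg; derive_pt.
Qed.

Lemma continuous_catalan_weight : continuous catalan_weight.
Proof.
by apply: has_deriv_continuous => x; eexists; rewrite /catalan_weight; derive_pt.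
Qed.

Lemma continuous_catalan_moment n :
  continuous (fun x => catalan_arg x ^+ n * catalan_weight x).
Proof.
apply: has_deriv_continuous => x; eexists.
rewrite /catalan_arg /catalan_weight; derive_pt.
Qed.

Lemma catalan_moment0 : \int[mu]_(x in `[0, 1]) catalan_weight x = pi / 8.
Proof.
(* With [x = tan f] the integrand is [cos (2 f) ^ 2 df], with primitive [f / 2 + sin (4 f) / 8]; [F]
   is this primitive in terms of [x]. *)
pose F (x : R) := 2^-1 * (atan x + x * (1 - x ^+ 2) / (1 + x ^+ 2) ^+ 2).
have -> : pi / 8 = F 1 - F 0 by rewrite /F atan1 atan0; lra.
apply: FTC01 continuous_catalan_weight => x.
apply: has_deriv_eq; first (rewrite /F; derive_pt).
by have := oneDsqr_neq0 x => x0; rewrite /catalan_weight /=; field.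
Qed.

(** The difference of the two sides integrates the derivative of a function vanishing at 0 and 1. Up
    to the factor 16, this is the recurrence of [catalan_succ]. *)
Lemma catalan_momentS n :
  (16 * n.+2)%:R * \int[mu]_(x in `[0, 1]) (catalan_arg x ^+ n.+1 * catalan_weight x) =
  (4 * n + 2)%:R * \int[mu]_(x in `[0, 1]) (catalan_arg x ^+ n * catalan_weight x).
Proof.
apply/esym/subr0_eq; rewrite -!RintegralZl//;
  try exact/integrable01/continuous_catalan_moment.
have cZ a m : continuous (fun x => a * (catalan_arg x ^+ m * catalan_weight x)).
  by move=> x; apply: cvgM; [exact: cvg_cst|exact: continuous_catalan_moment].
rewrite -RintegralB//; try exact/integrable01/cZ.
(* With [x = tan f] this is [sin (2 f) ^ (2 n + 1) * cos (2 f) ^ 3 / 4 ^ n]. *)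
pose F (x : R) := catalan_arg x ^+ n * (x * 2 * (1 - x ^+ 2) ^+ 3 / (1 + x ^+ 2) ^+ 4).
transitivity (F 1 - F 0); last by rewrite /F; ring.
apply: FTC01 => [x|x]; last by apply: cvgB; exact: cZ.
apply: has_deriv_eq; first (rewrite /F /catalan_arg; derive_pt).
have := oneDsqr_neq0 x => x0; rewrite /catalan_weight /catalan_arg /=.
(* The power rule leaves the exponent [n.-1], so [n = 0] is checked apart. *)
case: n {F} => [|n] /=; rewrite ?exprS ?expr0; first by field.
by set Q := _ ^+ n; field.
Qed.

Lemma catalan_moment n :
  \int[mu]_(x in `[0, 1]) (catalan_arg x ^+ n * catalan_weight x) =
  pi / 8 * (catalan R n / 16 ^+ n).
Proof.
elim: n => [|n IH].
  rewrite catalan0 expr0 divr1 mulr1 -catalan_moment0.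
  by apply: eq_Rintegral => x _; rewrite expr0 mul1r.
have n0 : (16 * n.+2)%:R != 0 :> R by rewrite pnatr_eq0.
apply: (mulfI n0); rewrite catalan_momentS IH.
have -> : (16 * n.+2)%:R * (pi / 8 * (catalan R n.+1 / 16 ^+ n.+1)) =
    pi / 8 / 16 ^+ n * (n.+2%:R * catalan R n.+1).
  rewrite exprS; have : (16:R) ^+ n != 0 by rewrite expf_neq0.
  by move: (_ ^+ n) => a a0; field.
by rewrite catalan_succ; field; rewrite expf_neq0.
Qed.

End catalan_moments.

(** * The star sum as an integral *)

Section star_integral.
Context (R : realType).
Let mu := @lebesgue_measure R.

Lemma catalan_arg_ge0 (x : R) : 0 <= catalan_arg x.
Proof. by rewrite /catalan_arg divr_ge0 ?sqr_ge0. Qed.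

(* Each summation over [m i] contributes a factor
   [\sum_k catalan k * q ^+ k = 1 + x ^+ 2]. *)
Lemma esum_catalan_integral (s : nat) (g : R -> R) :
  measurable_fun [set: R] g -> (forall x, 0 <= g x) ->
  (\esum_(m in [set: {ffun 'I_s -> nat}])
    ((\prod_(i < s) catalan R (m i))%:E *
     \int[mu]_(x in `[0%R, 1%R]) (catalan_arg x ^+ (\sum_(i < s) m i)%N * g x)%:E) =
  \int[mu]_(x in `[0%R, 1%R]) ((1 + x ^+ 2) ^+ s * g x)%:E)%E.
Proof.
have mq n : measurable_fun [set: R] (fun x : R => catalan_arg x ^+ n).
  apply: measurable_funX.
  apply: continuous_measurable_fun.
  exact: continuous_catalan_arg.
have m1 n : measurable_fun [set: R] (fun x : R => (1 + x ^+ 2) ^+ n).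
  apply: continuous_measurable_fun; apply: has_deriv_continuous => x.
  by eexists; derive_pt.
elim: s g => [|s IH] g mg g0.
  have -> : [set: {ffun 'I_0 -> nat}] = [set [ffun=> 0%N]].
    by apply/seteqP; split=> // m _ /=; apply/ffunP => -[].
  rewrite esum_set1 !big_ord0 mul1e; first by apply: eq_integral => x _; rewrite !expr0.
  by apply: integral_ge0 => x _; rewrite lee_fin expr0 mul1r.
(* [e] prepends [p.1] to the tuple [p.2]; this bijection isolates the summation over the first
   index. *)
pose e (p : nat * {ffun 'I_s -> nat}) : {ffun 'I_s.+1 -> nat} :=
  [ffun i => oapp p.2 p.1 (unlift ord0 i)].
rewrite (reindex_esum ([set: nat] `*`` (fun=> [set: {ffun 'I_s -> nat}])) _ e);
  last first.
  split => //=.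
    move=> [k m] [k' m'] _ _ /ffunP h; congr pair.
      by have := h ord0; rewrite !ffunE unlift_none.
    by apply/ffunP => i; have := h (lift ord0 i); rewrite !ffunE liftK.
  move=> m _; exists (m ord0, [ffun i => m (lift ord0 i)]) => //.
  by apply/ffunP => i; rewrite ffunE; case: unliftP => [j|] -> //=; rewrite ffunE.
have eP p : \prod_(i < s.+1) catalan R (e p i) =
    catalan R p.1 * \prod_(i < s) catalan R (p.2 i).
  rewrite big_ord_recl !ffunE unlift_none /=; congr (_ * _).
  by apply: eq_bigr => i _; rewrite ffunE liftK.
have eS p : (\sum_(i < s.+1) e p i = p.1 + \sum_(i < s) p.2 i)%N.
  rewrite big_ord_recl !ffunE unlift_none /=; congr (_ + _)%N.
  by apply: eq_bigr => i _; rewrite ffunE liftK.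
under eq_esum do rewrite eP eS.
have mI k : measurable_fun [set: R] (fun x => catalan R k * catalan_arg x ^+ k * g x).
  by apply: measurable_funM => //; apply: measurable_funM.
rewrite -(@esum_esum _ _ _ setT (fun=> setT) (fun k (m : {ffun 'I_s -> nat}) =>
  ((catalan R k * \prod_(i < s) catalan R (m i))%:E *
   \int[mu]_(x in `[0%R, 1%R])
     (catalan_arg x ^+ (k + \sum_(i < s) m i)%N * g x)%:E)%E)); last first.
  move=> k m _ _; rewrite mule_ge0//.
    by rewrite lee_fin mulr_ge0 ?catalan_ge0// prodr_ge0// => i _; exact: catalan_ge0.
  by apply: integral_ge0 => x _; rewrite lee_fin mulr_ge0 ?exprn_ge0 ?catalan_arg_ge0.
(* The induction hypothesis is used with the weight [catalan R k * catalan_arg x ^+ k * g x], which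
   absorbs the isolated index; hence the general [g]. *)
transitivity (\esum_(k in [set: nat]) \int[mu]_(x in `[0%R, 1%R])
    ((1 + x ^+ 2) ^+ s * (catalan R k * catalan_arg x ^+ k * g x))%:E)%E.
  apply: eq_esum => k _; rewrite -IH//; last first.
    move=> x; rewrite mulr_ge0// mulr_ge0 ?catalan_ge0// exprn_ge0//.
    exact: catalan_arg_ge0.
  apply: eq_esum => m _; rewrite mulrC EFinM -muleA; congr (_ * _)%E.
  rewrite -ge0_integralZl//=.
  - by apply: eq_integral => x _; rewrite -EFinM exprD; congr (_%:E); ring.
  - apply/measurable_EFinP; apply: measurable_funTS.
    by apply: measurable_funM; [exact: mq|exact: mg].
  - by move=> x _; rewrite lee_fin mulr_ge0 ?exprn_ge0 ?catalan_arg_ge0.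
  - by rewrite lee_fin catalan_ge0.
rewrite -nneseries_esumT; last first.
  move=> k; apply: integral_ge0 => x _; rewrite lee_fin.
  by rewrite !mulr_ge0 ?exprn_ge0 ?catalan_ge0 ?catalan_arg_ge0// addr_ge0 ?sqr_ge0.
rewrite -integral_nneseries//; last 2 first.
- move=> k; apply/measurable_EFinP; apply: measurable_funTS.
  by apply: measurable_funM; [exact: m1|exact: mI].
- move=> k x _; rewrite lee_fin.
  by rewrite !mulr_ge0 ?exprn_ge0 ?catalan_ge0 ?catalan_arg_ge0// addr_ge0 ?sqr_ge0.
apply: eq_integral => x; rewrite inE/= in_itv/= => x01.
apply: cvg_lim => //.
have -> : (fun n => \sum_(0 <= k < n)
      ((1 + x ^+ 2) ^+ s * (catalan R k * catalan_arg x ^+ k * g x))%:E)%E =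
    EFin \o (fun n => (1 + x ^+ 2) ^+ s *
      (\sum_(0 <= k < n) catalan R k * catalan_arg x ^+ k) * g x).
  apply/funext => n /=; rewrite sumEFin mulr_sumr mulr_suml; congr (_%:E).
  by apply: eq_bigr => k _; rewrite !mulrA.
apply: cvg_EFin; first exact: nearW.
rewrite [_ ^+ s.+1]exprSr; apply: cvgM; last exact: cvg_cst.
apply: cvgM; first exact: cvg_cst.
exact: cvg_catalan_series.
Qed.

(** At [t = 1 / 4] the power of [t] is [16^-n], the normalization of [catalan_moment]. Three of the
    [s + 3] factors [1 + x ^+ 2] cancel the denominator of [catalan_weight], which explains the
    shift by 3. *)
Lemma star_value_integral (s : nat) :
  star_value R (s + 3) = (8 / pi *
   \int[mu]_(x in `[0, 1]) ((1 - x ^+ 2) ^+ 2 * (1 + x ^+ 2) ^+ s))%:E.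
Proof.
have pi0 : pi != 0 :> R by rewrite gt_eqF ?pi_gt0.
have c x : 0 <= 8 / pi * catalan_weight x :> R.
  rewrite mulr_ge0 ?divr_ge0 ?pi_ge0//; first by rewrite sqr_ge0.
  by rewrite exprn_ge0// addr_ge0 ?sqr_ge0.
transitivity (\int[mu]_(x in `[0%R, 1%R])
    ((1 + x ^+ 2) ^+ (s + 3) * (8 / pi * catalan_weight x))%:E)%E.
  rewrite -esum_catalan_integral//; last first.
    apply: measurable_funM; first exact: measurable_cst.
    by apply: continuous_measurable_fun; exact: continuous_catalan_weight.
  rewrite /star_value /star_sum; apply: eq_esum => m _.
  rewrite -mulrA EFinM; congr (_ * _)%E; rewrite -big_distrr/=.
  set n := (\sum_(i < _) m i)%N.
  have cw : continuous (fun x : R => 8 / pi * (catalan_arg x ^+ n * catalan_weight x)).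
    by move=> x; apply: cvgM; [exact: cvg_cst|exact: continuous_catalan_moment].
  under eq_integral => x _ do rewrite mulrCA.
  rewrite integral01_Rintegral// RintegralZl//; last first.
    exact/integrable01/continuous_catalan_moment.
  rewrite catalan_moment -exprVn exprM; congr (_%:E).
  have -> : (1 / 4) ^+ 2 = 16^-1 :> R by field.
  by move: (pi : R) pi0 => p p0; field.
have cp : continuous (fun x : R => (1 - x ^+ 2) ^+ 2 * (1 + x ^+ 2) ^+ s).
  by apply: has_deriv_continuous => x; eexists; derive_pt.
rewrite -RintegralZl//; last exact: integrable01.
rewrite -integral01_Rintegral; last first.
  by move=> x; apply: cvgM; [exact: cvg_cst|exact: cp].
apply: eq_integral => x _; congr (_%:E); rewrite /catalan_weight exprD.
have := oneDsqr_neq0 x; set A := _ ^+ s => x0.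
by move: (pi : R) pi0 => p p0; field; rewrite p0.
Qed.

End star_integral.

(** * Closed form by binomial expansion *)

Lemma integral01_star_weight (R : realType) (s : nat) :
  \int[@lebesgue_measure R]_(x in `[0, 1]) ((1 - x ^+ 2) ^+ 2 * (1 + x ^+ 2) ^+ s) =
  8 * \sum_(0 <= k < s.+1)
    'C(s, k)%:R / ((2 * k + 1)%:R * (2 * k + 3)%:R * (2 * k + 5)%:R).
Proof.
(* A primitive of [(1 - x^2)^2 x^(2k)]. At 1 it equals [1/(2k+1) - 2/(2k+3) + 1/(2k+5)], that is 8
   over the product of the denominators. *)
pose G k (x : R) := x ^+ (2 * k + 1) / (2 * k + 1)%:R
  - 2 * (x ^+ (2 * k + 3) / (2 * k + 3)%:R) + x ^+ (2 * k + 5) / (2 * k + 5)%:R.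
pose F (x : R) := \sum_(k < s.+1) 'C(s, k)%:R * G k x.
have dG k (x : R) : has_deriv (G k) x ((1 - x ^+ 2) ^+ 2 * (x ^+ 2) ^+ k).
  apply: has_deriv_eq; first (rewrite /G; derive_pt).
  have h m : (2 * k + m.+1)%:R != 0 :> R by rewrite addnS pnatr_eq0.
  have eX m : x ^+ (2 * k + m.+1).-1 = (x ^+ 2) ^+ k * x ^+ m.
    by rewrite addnS /= exprD exprM.
  rewrite !eX; set A := (x ^+ 2) ^+ k.
  have := h 0%N; have := h 2%N; have := h 4%N.
  move: ((2 * k + 1)%:R : R) ((2 * k + 3)%:R : R) ((2 * k + 5)%:R : R) => a b c c0 b0 a0.
  rewrite !mulr0 !add0r !addr0; clearbody A; field.
  by rewrite c0 b0 a0.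
have dF (x : R) : has_deriv F x ((1 - x ^+ 2) ^+ 2 * (1 + x ^+ 2) ^+ s).
  apply: (@has_deriv_eq _ _ _
      (\sum_(k < s.+1) 'C(s, k)%:R * ((1 - x ^+ 2) ^+ 2 * (x ^+ 2) ^+ k))).
    have -> : F = \sum_(k < s.+1) (fun x => 'C(s, k)%:R * G k x).
      by apply/funext => y; rewrite fct_sumE.
    rewrite /has_deriv; apply: is_derive_sum => k; apply: has_deriv_eq.
      by apply: has_derivM; [exact: has_deriv_cst|exact: dG].
    by rewrite mulr0 addr0.
  rewrite (exprDn 1 (x ^+ 2)) mulr_sumr; apply: eq_bigr => k _.
  by rewrite expr1n mul1r -[_ *+ _]mulr_natr; ring.
rewrite (FTC01 dF); last by apply: has_deriv_continuous => x; eexists; derive_pt.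
rewrite /F big_mkord mulr_sumr -sumrB; apply: eq_bigr => k _.
rewrite /G !expr1n !(addnS (2 * k)) !expr0n /= !mul0r.
have h m : (2 * k + m).+1%:R != 0 :> R by rewrite pnatr_eq0.
have [h0 h2 h4] : [/\ (2 * k + 0).+1%:R != 0 :> R, (2 * k + 2).+1%:R != 0 :> R &
   (2 * k + 4).+1%:R != 0 :> R] by split; exact: h.
field.
by rewrite -natrM -!natrD nat1r !pnatr_eq0.
Qed.

(** * Asymptotics of Beta-type integrals *)

Section beta_asymptotics.
Context (R : realType).
Let mu := @lebesgue_measure R.

Lemma cvg_exprn (u : nat -> R) (l : R) n :
  u @ \oo --> l -> (u k ^+ n) @[k --> \oo] --> l ^+ n.
Proof.
move=> ul; elim: n => [|n IH].
  by under eq_fun do rewrite expr0; exact: cvg_cst.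
by rewrite exprS; under eq_fun do rewrite exprS; exact: cvgM.
Qed.

Lemma cvg_1_harmonic : (1 + harmonic n : R) @[n --> \oo] --> (1 : R).
Proof.
rewrite -[X in _ --> X]addr0; apply: cvgD; first exact: cvg_cst.
exact: cvg_harmonic.
Qed.

(** The distance to the limiting fixed point [L] is eventually contracted by a fixed [r < 1], up to
    an error tending to 0. *)
Lemma affine_recurrence_cvg (u a b : nat -> R) (l m : R) : `|l| < 1 ->
  (forall n, u n.+1 = a n * u n + b n) ->
  a @ \oo --> l -> b @ \oo --> m -> u @ \oo --> m / (1 - l).
Proof.
move=> l1 uE al bm; set L := m / (1 - l).
have lL : m + l * L - L = 0.
  have ? : 1 - l != 0 by rewrite subr_eq0 gt_eqF// (le_lt_trans (ler_norm l)).
  by rewrite /L; field.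
have cL : (b n + a n * L - L) @[n --> \oo] --> (0 : R).
  rewrite -lL; apply: cvgB; last exact: cvg_cst.
  by apply: cvgD => //; apply: cvgM => //; exact: cvg_cst.
pose r := (1 + `|l|) / 2.
have r0 : 0 <= r by rewrite divr_ge0// addr_ge0.
have r1 : r < 1 by rewrite /r; lra.
have lr : `|l| < r by rewrite /r; lra.
apply/cvgrPdist_le => e e0.
have e2 : 0 < e / 2 by rewrite divr_gt0.
(* An error of this size keeps the bound [e / 2] invariant:
   [r * (e / 2) + e / 2 * (1 - r) = e / 2]. *)
have er : 0 < e / 2 * (1 - r) by rewrite mulr_gt0// subr_gt0.
have near_a : \forall n \near \oo, `|a n| <= r.
  have rl : 0 < r - `|l| by rewrite subr_gt0.
  move/cvgrPdist_le : al => /(_ _ rl); apply: filterS => n h.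
  have := ler_normD l (a n - l); rewrite addrC subrK => /le_trans; apply.
  by rewrite -lerBrDl distrC.
have near_c : \forall n \near \oo, `|b n + a n * L - L| <= e / 2 * (1 - r).
  move/cvgrPdist_le : cL => /(_ _ er); apply: filterS => n.
  by rewrite sub0r normrN.
have [N _ hN] : \forall n \near \oo,
    `|a n| <= r /\ `|b n + a n * L - L| <= e / 2 * (1 - r).
  by near=> n; split; near: n.
have bound k : `|u (k + N)%N - L| <= e / 2 + r ^+ k * `|u N - L|.
  elim: k => [|k IH]; first by rewrite add0n expr0 mul1r lerDr ltW.
  have [ha hc] := hN (k + N)%N (leq_addl _ _).
  rewrite addSn uE.
  have -> : a (k + N)%N * u (k + N)%N + b (k + N)%N - L =
    a (k + N)%N * (u (k + N)%N - L) + (b (k + N)%N + a (k + N)%N * L - L) by ring.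
  apply: (le_trans (ler_normD _ _)); rewrite normrM.
  apply: (@le_trans _ _ (r * (e / 2 + r ^+ k * `|u N - L|) + e / 2 * (1 - r))).
    by apply: lerD => //; apply: ler_pM.
  by rewrite exprS; lra.
have geo : (r ^+ k * `|u N - L|) @[k --> \oo] --> (0 : R).
  rewrite -(mul0r `|u N - L|); apply: cvgM; last exact: cvg_cst.
  by apply: cvg_expr; rewrite ger0_norm.
have [K _ hK] : \forall k \near \oo, r ^+ k * `|u N - L| <= e / 2.
  move/cvgrPdist_le : geo => /(_ _ e2); apply: filterS => n.
  by rewrite sub0r normrN; exact: le_trans (ler_norm _).
exists (K + N)%N => // n /= Kn.
have nN : (N <= n)%N by rewrite (leq_trans _ Kn)// leq_addl.
rewrite -(subnK nN) distrC (le_trans (bound _))// [leRHS]splitr lerD2l.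
by apply: hK; rewrite /= leq_subRL// addnC.
Unshelve. all: by end_near.
Qed.

(** With [u = (1 - x^2) / 2] this is the integral of [u^j (1 - u)^s (1 - 2 u)^(-1/2)] over [0, 1/2].
    Halving takes out the growth [2^s], leaving polynomial decay. *)
Definition beta_half (j s : nat) : R :=
  \int[mu]_(x in `[0, 1]) (((1 - x ^+ 2) / 2) ^+ j * ((1 + x ^+ 2) / 2) ^+ s).

Lemma continuous_beta_half j s :
  continuous (fun x : R => ((1 - x ^+ 2) / 2) ^+ j * ((1 + x ^+ 2) / 2) ^+ s).
Proof. by apply: has_deriv_continuous => x; eexists; derive_pt. Qed.

(* Integrate the derivative of
   [x * ((1 - x ^+ 2) / 2) ^+ j * ((1 + x ^+ 2) / 2) ^+ s.+1] over [[0, 1]]. *)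
Lemma beta_half_rec j s :
  (2 * s + 2 * j + 3)%:R * beta_half j s.+1 =
  s.+1%:R * beta_half j s + j%:R * beta_half j.-1 s.+1 + (j == 0%N)%:R.
Proof.
pose f i t (x : R) := ((1 - x ^+ 2) / 2) ^+ i * ((1 + x ^+ 2) / 2) ^+ t.
have cf i t := @continuous_beta_half i t : continuous (f i t).
have cZ c i t : continuous (fun x => c * f i t x).
  by move=> x; apply: cvgM; [exact: cvg_cst|exact: cf].
suff <- : (2 * s + 2 * j + 3)%:R * beta_half j s.+1 - s.+1%:R * beta_half j s
    - j%:R * beta_half j.-1 s.+1 = (j == 0%N)%:R by ring.
rewrite /beta_half -!RintegralZl//; try exact/integrable01/cf.
rewrite -RintegralB//; try exact/integrable01/cZ.
rewrite -RintegralB//; last 2 first.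
- by apply: integrable01 => x; apply: cvgB; exact: cZ.
- exact/integrable01/cZ.
pose F (x : R) := x * (((1 - x ^+ 2) / 2) ^+ j * ((1 + x ^+ 2) / 2) ^+ s.+1).
(* [F 1 = 0 ^+ j], so the boundary term survives only for [j = 0]. *)
transitivity (F 1 - F 0); last first.
  rewrite /F mul0r expr1n subrr mul0r expr0n subr0 mul1r (_ : 1 + 1 = 2)//.
  by rewrite divff// expr1n mulr1.
apply: FTC01 => x; last by apply: cvgB; [apply: cvgB|]; exact: cZ.
apply: has_deriv_eq; first (rewrite /F; derive_pt).
(* Since [x^2 = 1 - 2 p = 2 r - 1], the factors [x^2] from the product rule become shifts of the
   exponents. *)
set r := (1 + x ^+ 2) / 2; set p := (1 - x ^+ 2) / 2; rewrite /f -/r -/p /=.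
set Q := r ^+ s.
have jp : j%:R * p ^+ j = p * (j%:R * p ^+ j.-1).
  by case: (j) => [|i]; rewrite ?mul0r ?mulr0// exprS mulrCA.
rewrite [r ^+ _]exprS -/Q.
have -> : (2 * s + 2 * j + 3)%:R * (p ^+ j * (r * Q)) =
  (2 * s + 3)%:R * (p ^+ j * (r * Q)) + 2 * (j%:R * p ^+ j) * (r * Q) by ring.
rewrite jp ![j%:R * (_ * _)]mulrA.
move: (j%:R * _) (p ^+ j) Q => J P Q; rewrite /r /p expr1; by field.
Qed.

(** Rescaled by [s ^+ j.+1], [beta_half_rec] is an affine recurrence whose coefficients tend to
    [1 / 2] and [l / 2]; its limit is [(l / 2) / (1 - 1 / 2) = l]. *)
Lemma cvg_beta_half_step j (l : R) :
  (n%:R ^+ j * (j%:R * beta_half j.-1 n + (j == 0%N)%:R)) @[n --> \oo] --> l ->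
  (s%:R ^+ j.+1 * beta_half j s) @[s --> \oo] --> l.
Proof.
move=> bl.
(* Starting at index 1 makes the division by [n.+1%:R ^+ j.+1] in the recurrence legitimate. *)
rewrite -cvg_shiftS /=.
have ratio : ((n.+2)%:R / (2 * n + 2 * j + 5)%:R : R) @[n --> \oo] --> (2^-1 : R).
  have -> : (fun n => (n.+2)%:R / (2 * n + 2 * j + 5)%:R : R) =
      (fun n => (2 + (2 * j + 1)%:R * harmonic n.+1)^-1).
    apply/funext => n; rewrite /harmonic /=.
    have n2 : n.+2%:R != 0 :> R by rewrite pnatr_eq0.
    have -> : (2 * n + 2 * j + 5)%:R = 2 * n.+2%:R + (2 * j + 1)%:R :> R by ring.
    have : 2 * n.+2%:R + (2 * j + 1)%:R != 0 :> R by rewrite -natrM -natrD pnatr_eq0.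
    by move: (n.+2%:R : R) ((2 * j + 1)%:R : R) n2 => a b a0 ab0; field; rewrite a0 ab0.
  apply: cvgV => //; rewrite -[X in _ --> X]addr0 -(mulr0 (2 * j + 1)%:R).
  apply: cvgD; first exact: cvg_cst.
  by apply: cvgM; [exact: cvg_cst|rewrite cvg_shiftS; exact: cvg_harmonic].
have -> : l = (2^-1 * l) / (1 - 2^-1) by field.
pose a n : R := (1 + harmonic n) ^+ j.+1 * (n.+2%:R / (2 * n + 2 * j + 5)%:R).
pose b n : R := n.+2%:R / (2 * n + 2 * j + 5)%:R *
  (n.+2%:R ^+ j * (j%:R * beta_half j.-1 n.+2 + (j == 0%N)%:R)).
apply: (@affine_recurrence_cvg _ a b).
- by rewrite ger0_norm// invf_lt1// ltr1n.
- move=> n; rewrite /a /b.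
  have n1 : n.+1%:R != 0 :> R by rewrite pnatr_eq0.
  have -> : 1 + harmonic n = n.+2%:R / n.+1%:R :> R.
    by rewrite /harmonic /= -[n.+2%:R]natr1; field.
  have d0 : (2 * n + 2 * j + 5)%:R != 0 :> R by rewrite !addnS pnatr_eq0.
  have := beta_half_rec j n.+1.
  have -> : (2 * n.+1 + 2 * j + 3 = 2 * n + 2 * j + 5)%N by ring.
  move=> /(canRL (mulKf d0)) ->; rewrite expr_div_n.
  have nj : n.+1%:R ^+ j.+1 != 0 :> R by rewrite expf_neq0.
  rewrite [n.+2%:R ^+ j.+1]exprS.
  move: (beta_half _ _) (beta_half _ _) (_ == _)%:R (n.+2%:R ^+ j) (n.+1%:R ^+ _) nj
    ((2 * n + 2 * j + 5)%:R : R) d0.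
  move=> B B' D N M M0 d d0.
  by field; rewrite M0 d0.
- have -> : 2^-1 = 1 ^+ j.+1 * 2^-1 :> R by rewrite expr1n mul1r.
  apply: cvgM => //.
  exact/cvg_exprn/cvg_1_harmonic.
- apply: cvgM => //.
  by move: bl; rewrite -cvg_shiftS -cvg_shiftS; apply.
Qed.

Lemma cvg_beta_half j :
  (s%:R ^+ j.+1 * beta_half j s) @[s --> \oo] --> (j`!%:R : R).
Proof.
elim: j => [|j IH]; apply: cvg_beta_half_step => /=.
  rewrite fact0; under eq_fun do rewrite expr0 mul0r add0r mul1r.
  exact: cvg_cst.
rewrite factS natrM; under eq_fun do rewrite addr0 mulrCA.
by apply: cvgM; [exact: cvg_cst|exact: IH].
Qed.

End beta_asymptotics.

(** * Closed form and asymptotic equivalence of the star values *)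

Theorem theorem29 (R : realType) :
  (forall s : nat,
     star_value R (s + 3) =
     (64 / pi * \sum_(0 <= k < s.+1)
        'C(s, k)%:R / ((2 * k + 1)%:R * (2 * k + 3)%:R * (2 * k + 5)%:R))%:E)
  /\
  (fun s : nat => fine (star_value R s)) ~_\oo
    (fun s : nat => 8 / pi * (2 ^+ s / s%:R ^+ 3)).
Proof.
split=> [s|].
  rewrite star_value_integral integral01_star_weight mulrA; congr (_ * _)%:E.
  by rewrite mulrAC; congr (_ / _); ring.
(* This is the ratio of [A_(n+4)] to its claimed equivalent; its limit is [2! / 2 = 1]. *)
have rho1 : (n.+4%:R ^+ 3 / 2 * beta_half R 2 n.+1) @[n --> \oo] --> (1 : R).
  have -> : (fun n => n.+4%:R ^+ 3 / 2 * beta_half R 2 n.+1) =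
      (fun n => (1 + 3 * harmonic n) ^+ 3 / 2 * (n.+1%:R ^+ 3 * beta_half R 2 n.+1)).
    apply/funext => n.
    have n1 : n.+1%:R != 0 :> R by rewrite pnatr_eq0.
    have -> : 1 + 3 * harmonic n = n.+4%:R / n.+1%:R :> R.
      rewrite /harmonic /= -[n.+4%:R]/((3 + n.+1)%:R) natrD.
      by move: (n.+1%:R : R) n1 => a a0; field.
    by rewrite expr_div_n; move: (n.+1%:R : R) n1 => a a0; field.
  have e1 : (1 + 3 * 0) ^+ 3 / 2 * 2`!%:R = 1 :> R.
    by rewrite mulr0 addr0 expr1n mul1r mulVf.
  rewrite -[X in _ --> X]e1.
  apply: cvgM; last by have := @cvg_beta_half R 2; rewrite -cvg_shiftS; apply.
  apply: cvgM; last exact: cvg_cst.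
  apply: cvg_exprn; apply: cvgD; first exact: cvg_cst.
  by apply: cvgM; [exact: cvg_cst|exact: cvg_harmonic].
apply/eqaddoP => e e0.
move/cvgrPdist_le : rho1 => /(_ _ e0) [N _ hN].
(* An index [n >= N + 4] is [m + 4] with [m >= N], reached by the integral formula at [m.+1]. *)
exists (N + 4)%N => // n /= Nn.
have -> : n = ((n - 4).+1 + 3)%N by lia.
have {Nn} : (N <= n - 4)%N by lia.
move: (n - 4)%N => {}n Nn.
have pi0 : pi != 0 :> R by rewrite gt_eqF ?pi_gt0.
have n4 : n.+4%:R != 0 :> R by rewrite pnatr_eq0.
rewrite !fctE star_value_integral /= addn3.
have -> : 8 / pi * (\int[lebesgue_measure]_(x in `[0, 1])
    ((1 - x ^+ 2) ^+ 2 * (1 + x ^+ 2) ^+ n.+1)) =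
    8 / pi * (2 ^+ n.+4 / n.+4%:R ^+ 3) * (n.+4%:R ^+ 3 / 2 * beta_half R 2 n.+1).
  have -> : \int[lebesgue_measure]_(x in `[0, 1])
      ((1 - x ^+ 2) ^+ 2 * (1 + x ^+ 2) ^+ n.+1) =
      4 * 2 ^+ n.+1 * beta_half R 2 n.+1.
    rewrite /beta_half -RintegralZl//; last exact/integrable01/continuous_beta_half.
    apply: eq_Rintegral => x _; rewrite !expr_div_n.
    have : (2 : R) ^+ n.+1 != 0 by rewrite expf_neq0.
    by move: (_ ^+ n.+1) (_ ^+ n.+1) => P Q Q0; field.
  rewrite (_ : 2 ^+ n.+4 = 8 * 2 ^+ n.+1); last by rewrite !exprS; ring.
  by move: (pi : R) pi0 (2 ^+ n.+1) (n.+4%:R : R) n4 => p p0 P a a0; field; rewrite p0 a0.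
set g := 8 / pi * _; rewrite -[X in _ - X]mulr1 -mulrBr normrM mulrC.
by rewrite ler_wpM2r// distrC hN.
Qed.
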